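(* Let $L,N\ge 0$ be integers with $2L\le 2N+1$, let $\{\tilde\Phi_\ell\}_{\ell\ge 0}$ be the normalized orthogonal polynomials with respect to the weight function $w$ on $[-1,1]$, let $x_0,\dots,x_N$ be the zeros of $\tilde\Phi_{N+1}$ and $\omega_0,\dots,\omega_N$ the corresponding Gauss quadrature weights. Let $f\in\mathcal C([-1,1])$, $\lambda>0$ and $0\le\mu_0\le\mu_1\le\dots\le\mu_L$. Then the problem $$\min_{\boldsymbol\beta\in\mathbb R^{L+1}}\ \|\mathbf W^{1/2}(\mathbf A_L\boldsymbol\beta-\mathbf f)\|_2^2+\lambda\|\mathbf R_L\boldsymbol\beta\|_1$$ has the unique solution $\boldsymbol\beta=[\beta_0,\dots,\beta_L]^T$ given in closed form by $$\beta_\ell=\frac12 S_{\lambda\mu_\ell}(2\alpha_\ell),\qquad \alpha_\ell=\sum_{j=0}^N\omega_j\tilde\Phi_\ell(x_j)f(x_j),\qquad \ell=0,1,\dots,L.$$ Consequently, the $\ell_1$-regularized approximation polynomial $p^{\ell_1}_{L,N+1}=\sum_{\ell=0}^L\beta_\ell\tilde\Phi_\ell$ is $$p^{\ell_1}_{L,N+1}(x)=\frac12\sum_{\ell=0}^{L}S_{\lambda\mu_\ell}(2\alpha_\ell)\,\tilde\Phi_\ell(x).$$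
   Context: The weight function $w:(-1,1)\to\mathbb R$ is positive with $\int_{-1}^1 w(x)\,dx<\infty$ and $\int_{-1}^1x^iw(x)\,dx<\infty$ for $i=1,2,\dots$. $\tilde\Phi_\ell$ is a polynomial of degree $\ell$, and $\int_{-1}^1w(x)\tilde\Phi_\ell(x)\tilde\Phi_{\ell'}(x)\,dx=\delta_{\ell,\ell'}$. The Gauss quadrature weights $\omega_j>0$ are those for which $\sum_{j=0}^N\omega_jp(x_j)=\int_{-1}^1w(x)p(x)\,dx$ for all polynomials $p$ of degree at most $2N+1$. $\mathbf A_L=[\tilde\Phi_\ell(x_j)]\in\mathbb R^{(N+1)\times(L+1)}$ (row index $j=0,\dots,N$, column index $\ell=0,\dots,L$), $\mathbf W=\mathrm{diag}(\omega_0,\dots,\omega_N)$, $\mathbf f=[f(x_0),\dots,f(x_N)]^T$, $\mathbf R_L=\mathrm{diag}(\mu_0,\dots,\mu_L)$. The soft threshold operator is $S_k(a)=\max(0,a-k)+\min(0,a+k)$. *)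

(* Defs.v *)
From HB Require Import structures.
From mathcomp Require Export all_boot all_order all_algebra.
From mathcomp Require Export all_classical all_reals all_analysis.
Export Order.TTheory GRing.Theory Num.Theory.
Export numFieldNormedType.Exports.

Set Implicit Arguments.
Unset Strict Implicit.
Unset Printing Implicit Defensive.

Local Open Scope classical_set_scope.
Local Open Scope ring_scope.

(* Only the values of w on ]-1, 1[ matter.  The case i = 0 of the second clause
   is the finiteness of the integral of w. *)
Definition is_weight (R : realType) (w : R -> R) : Prop :=
  (forall x : R, -1 < x < 1 -> 0 < w x) /\
  (forall i : nat, (@lebesgue_measure R).-integrable `]-1, 1[
                     (fun x : R => (x ^+ i * w x)%:E)).

Definition wint (R : realType) (w g : R -> R) : R :=
  \int[@lebesgue_measure R]_(x in `]-1, 1[) (w x * g x).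

Definition normalized_orthogonal_polys (R : realType) (w : R -> R)
    (Phi : nat -> {poly R}) : Prop :=
  (forall l : nat, size (Phi l) = l.+1) /\
  (forall l l' : nat,
     wint w (fun x : R => (Phi l).[x] * (Phi l').[x]) = (l == l')%:R).

Definition are_zeros (R : realType) (n : nat) (p : {poly R}) (x : 'I_n -> R) : Prop :=
  injective x /\ (forall z : R, root p z <-> exists j : 'I_n, x j = z).

Definition gauss_weights (R : realType) (N : nat) (w : R -> R)
    (x omega : 'I_N.+1 -> R) : Prop :=
  (forall j : 'I_N.+1, 0 < omega j) /\
  (forall p : {poly R}, (size p <= (2 * N + 1).+1)%N ->
     \sum_(j < N.+1) omega j * p.[x j] = wint w (horner p)).

Definition soft (R : realType) (k a : R) : R :=
  Num.max 0 (a - k) + Num.min 0 (a + k).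

(* The norm `|v| that the library puts on matrices is the sup norm. *)
Definition norm1 (R : realType) (n : nat) (v : 'cV[R]_n) : R :=
  \sum_(i < n) `|v i 0|.

Definition norm2 (R : realType) (n : nat) (v : 'cV[R]_n) : R :=
  Num.sqrt (\sum_(i < n) v i 0 ^+ 2).

Definition sampling_mx (R : realType) (N L : nat) (Phi : nat -> {poly R})
    (x : 'I_N.+1 -> R) : 'M[R]_(N.+1, L.+1) :=
  \matrix_(j < N.+1, l < L.+1) (Phi l).[x j].

Definition diag_of (R : realType) (n : nat) (d : 'I_n -> R) : 'M[R]_n :=
  diag_mx (\row_(i < n) d i).

(* The matrix W^(1/2) is [diag_of (fun j => Num.sqrt (omega j))]. *)
Definition l1_objective (R : realType) (N L : nat) (Phi : nat -> {poly R})
    (x omega : 'I_N.+1 -> R) (f : R -> R) (lambda : R) (mu : 'I_L.+1 -> R)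
    (beta : 'cV[R]_L.+1) : R :=
  norm2 (diag_of (fun j : 'I_N.+1 => Num.sqrt (omega j)) *m
           (sampling_mx L Phi x *m beta - \col_(j < N.+1) f (x j))) ^+ 2
  + lambda * norm1 (diag_of mu *m beta).

Definition is_minimizer (R : realType) (T : Type) (J : T -> R) (b : T) : Prop :=
  forall b' : T, J b <= J b'.

Definition is_l1_approx_poly (R : realType) (N L : nat) (Phi : nat -> {poly R})
    (x omega : 'I_N.+1 -> R) (f : R -> R) (lambda : R) (mu : 'I_L.+1 -> R)
    (p : {poly R}) : Prop :=
  exists2 beta : 'cV[R]_L.+1,
    is_minimizer (l1_objective Phi x omega f lambda mu) beta
    & p = \sum_(l < L.+1) beta l 0 *: Phi l.

(* Main.v *)
Require Import Defs.
From mathcomp Require Import ring lra.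

(** The Gauss rule is exact up to degree [2 N + 1 >= 2 L], so the polynomials
    [Phi 0, ..., Phi L], orthonormal for the weight [w], stay orthonormal for
    the discrete inner product carried by the nodes [x j] with masses
    [omega j] ([gauss_orthonormal]).  The sampling matrix therefore has
    orthonormal columns in that inner product, and expanding the square
    ([weighted_residual_expand]) decouples the objective: up to a constant
    independent of [beta] it is the sum over [l] of the scalar functions
    [y |-> y ^+ 2 - 2 * alpha l * y + lambda * mu l * `|y|].

    Each of these is the sum of [y ^+ 2] and of a convex function.  Its
    minimizer is [b = 2^-1 * soft (lambda * mu l) (2 * alpha l)] because
    [2 * (alpha l - b)] is a subgradient of the penalty at [b], which is what
    [soft_residual_bound] and [soft_residual_dual] say; strong convexity then
    makes the value at [y] exceed the value at [b] by at least
    [(y - b) ^+ 2] ([soft_strong_min]).  Summing over [l], the objective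
    exceeds its value at the vector of soft thresholds by at least the squared
    distance to it ([l1_objective_strong_min]), which gives minimality and
    uniqueness together. *)

Set Implicit Arguments.
Unset Strict Implicit.
Unset Printing Implicit Defensive.

Local Open Scope classical_set_scope.
Local Open Scope ring_scope.

(** With [soft_residual_dual], says that [t - soft k t] is a subgradient of
    [k * `|_|] at [soft k t]: thresholding is the proximal map of the
    absolute value. *)
Lemma soft_residual_bound (R : realType) (k t : R) :
  0 <= k -> `|t - soft k t| <= k.
Proof.
move=> k0; rewrite /soft ler_norml.
by case: (leP 0 (t - k)) => h1; case: (leP 0 (t + k)) => h2; apply/andP; split; lra.
Qed.

Lemma soft_residual_dual (R : realType) (k t : R) :
  0 <= k -> (t - soft k t) * soft k t = k * `|soft k t|.
Proof.
move=> k0; rewrite /soft.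
case: (leP 0 (t - k)) => h1; case: (leP 0 (t + k)) => h2.
- by rewrite addr0 ger0_norm //; ring.
- by exfalso; lra.
- by rewrite addr0 normr0 !mulr0.
- by rewrite add0r ltr0_norm //; ring.
Qed.

(** The subgradient inequality for [k * `|_|] at [b], to which the square adds
    exactly [(y - b) ^+ 2]. *)
Lemma soft_strong_min (R : realType) (k a y : R) (b := 2^-1 * soft k (2 * a)) :
  0 <= k ->
  b ^+ 2 - 2 * a * b + k * `|b| + (y - b) ^+ 2 <= y ^+ 2 - 2 * a * y + k * `|y|.
Proof.
move=> k0.
have sE : soft k (2 * a) = 2 * b by rewrite /b; field.
have hle := soft_residual_bound (2 * a) k0.
have hd := soft_residual_dual (2 * a) k0.
rewrite sE in hle hd; set g := 2 * a - 2 * b in hle hd.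
have {}hd : g * b = k * `|b|.
  by move: hd; rewrite normrM ger0_norm // => hd; lra.
have hy : g * y <= k * `|y|.
  apply: le_trans (ler_norm _) _.
  by rewrite normrM ler_wpM2r.
rewrite -hd; suff -> : b ^+ 2 - 2 * a * b + g * b + (y - b) ^+ 2 =
  y ^+ 2 - 2 * a * y + g * y by rewrite lerD2l.
by rewrite /g; ring.
Qed.

(** Normal equations for columns that are orthonormal in the weighted inner
    product: the quadratic part reduces to the Euclidean norm of [b]. *)
Lemma weighted_residual_expand (R : comNzRingType) (m n : nat) (A : 'M[R]_(m, n))
    (om f : 'I_m -> R) (b : 'cV[R]_n) :
  (forall l l', \sum_j om j * (A j l * A j l') = (l == l')%:R) ->
  \sum_j om j * ((A *m b) j 0 - f j) ^+ 2 =
  \sum_j om j * f j ^+ 2 +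
  \sum_l (b l 0 ^+ 2 - 2 * (\sum_j om j * A j l * f j) * b l 0).
Proof.
move=> ort.
have sq : \sum_j om j * (A *m b) j 0 ^+ 2 = \sum_l b l 0 ^+ 2.
  transitivity (\sum_j \sum_l \sum_l' b l 0 * b l' 0 * (om j * (A j l * A j l'))).
    apply: eq_bigr => j _; rewrite mxE expr2 mulr_suml mulr_sumr.
    apply: eq_bigr => l _; rewrite !mulr_sumr; apply: eq_bigr => l' _; ring.
  rewrite exchange_big; apply: eq_bigr => l _.
  rewrite exchange_big (bigD1 l) //= -mulr_sumr ort eqxx mulr1 big1 ?addr0 ?expr2 //.
  by move=> l' ll'; rewrite -mulr_sumr ort eq_sym (negPf ll') mulr0.
have cross : \sum_j om j * (A *m b) j 0 * f j =
             \sum_l (\sum_j om j * A j l * f j) * b l 0.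
  transitivity (\sum_j \sum_l om j * A j l * f j * b l 0).
    apply: eq_bigr => j _; rewrite mxE mulr_sumr mulr_suml.
    by apply: eq_bigr => l _; ring.
  by rewrite exchange_big; apply: eq_bigr => l _; rewrite mulr_suml.
transitivity (\sum_j om j * f j ^+ 2 +
  (\sum_j om j * (A *m b) j 0 ^+ 2 - 2 * \sum_j om j * (A *m b) j 0 * f j)).
  rewrite mulr_sumr -sumrB -big_split /=; apply: eq_bigr => j _; ring.
rewrite sq cross mulr_sumr -sumrB; congr (_ + _).
by apply: eq_bigr => l _; rewrite mulrA.
Qed.

(** The product of two of these polynomials has degree at most [2 L], which
    the quadrature rule integrates exactly. *)
Lemma gauss_orthonormal (R : realType) (L N : nat) (w : R -> R)
    (Phi : nat -> {poly R}) (x omega : 'I_N.+1 -> R) (l l' : nat) :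
  (2 * L <= 2 * N + 1)%N -> normalized_orthogonal_polys w Phi ->
  gauss_weights w x omega -> (l <= L)%N -> (l' <= L)%N ->
  \sum_j omega j * ((Phi l).[x j] * (Phi l').[x j]) = (l == l')%:R.
Proof.
move=> hLN [szPhi ortPhi] [_ exact_om] lL l'L; rewrite -ortPhi.
have -> : (fun t => (Phi l).[t] * (Phi l').[t]) = horner (Phi l * Phi l').
  by apply/funext => t; rewrite hornerM.
rewrite -exact_om; first by apply: eq_bigr => j _; rewrite hornerM.
apply: leq_trans (size_polyMleq _ _) _; rewrite !szPhi addSn addnS /=.
by rewrite ltnS; apply: leq_trans hLN; rewrite mul2n -addnn leq_add.
Qed.

Lemma l1_objectiveE (R : realType) (N L : nat) (Phi : nat -> {poly R})
    (x omega : 'I_N.+1 -> R) (f : R -> R) (lambda : R) (mu : 'I_L.+1 -> R)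
    (beta : 'cV[R]_L.+1) :
  (forall j, 0 <= omega j) -> (forall l, 0 <= mu l) ->
  l1_objective Phi x omega f lambda mu beta =
  \sum_j omega j * ((sampling_mx L Phi x *m beta) j 0 - f (x j)) ^+ 2 +
  \sum_l lambda * mu l * `|beta l 0|.
Proof.
move=> om0 mu0; rewrite /l1_objective /norm2 /norm1 /diag_of sqr_sqrtr.
  rewrite mulr_sumr; congr (_ + _); apply: eq_bigr => i _; rewrite mul_diag_mx !mxE.
    by rewrite exprMn sqr_sqrtr.
  by rewrite normrM ger0_norm // mulrA.
by apply: sumr_ge0 => i _; apply: sqr_ge0.
Qed.

Lemma l1_objective_strong_min (R : realType) (L N : nat) (w : R -> R)
    (Phi : nat -> {poly R}) (x omega : 'I_N.+1 -> R) (f : R -> R) (lambda : R)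
    (mu : 'I_L.+1 -> R) (beta : 'cV[R]_L.+1)
    (b := \col_(l < L.+1) (2^-1 * soft (lambda * mu l)
            (2 * \sum_(j < N.+1) omega j * (Phi l).[x j] * f (x j)))) :
  (2 * L <= 2 * N + 1)%N -> normalized_orthogonal_polys w Phi ->
  gauss_weights w x omega -> 0 <= lambda -> (forall l, 0 <= mu l) ->
  l1_objective Phi x omega f lambda mu b + \sum_l (beta l 0 - b l 0) ^+ 2
    <= l1_objective Phi x omega f lambda mu beta.
Proof.
move=> hLN hPhi hom lambda0 mu0.
have om0 j : 0 <= omega j by apply/ltW/hom.1.
have ort (l l' : 'I_L.+1) :
    \sum_j omega j * (sampling_mx L Phi x j l * sampling_mx L Phi x j l')
    = (l == l')%:R.
  under eq_bigr do rewrite !mxE.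
  by apply: (gauss_orthonormal hLN hPhi hom); rewrite -ltnS ltn_ord.
rewrite !l1_objectiveE // !(weighted_residual_expand _ _ ort).
rewrite -!addrA lerD2l -!big_split /=; apply: ler_sum => l _.
have -> : \sum_j omega j * sampling_mx L Phi x j l * f (x j) =
          \sum_j omega j * (Phi l).[x j] * f (x j).
  by apply: eq_bigr => j _; rewrite mxE.
by rewrite mxE addrA soft_strong_min // mulr_ge0.
Qed.

Theorem theorem2p3 (R : realType) (L N : nat) (hLN : (2 * L <= 2 * N + 1)%N)
    (w : R -> R) (hw : is_weight w)
    (Phi : nat -> {poly R}) (hPhi : normalized_orthogonal_polys w Phi)
    (x : 'I_N.+1 -> R) (hx : are_zeros (Phi N.+1) x)
    (omega : 'I_N.+1 -> R) (homega : gauss_weights w x omega)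
    (f : R -> R) (hf : {within `[-1, 1], continuous f})
    (lambda : R) (hlambda : 0 < lambda)
    (mu : 'I_L.+1 -> R) (hmu0 : forall l : 'I_L.+1, 0 <= mu l)
    (hmu : forall l l' : 'I_L.+1, (l <= l')%N -> mu l <= mu l') :
  let alpha (l : 'I_L.+1) : R :=
    \sum_(j < N.+1) omega j * (Phi l).[x j] * f (x j) in
  unique (is_minimizer (l1_objective Phi x omega f lambda mu))
    (\col_(l < L.+1) (2^-1 * soft (lambda * mu l) (2 * alpha l)))
  /\
  (forall p : {poly R}, is_l1_approx_poly Phi x omega f lambda mu p ->
     forall t : R,
       p.[t] = 2^-1 * \sum_(l < L.+1)
                        soft (lambda * mu l) (2 * alpha l) * (Phi l).[t]).
Proof.
move=> alpha.
set b := \col_l _.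
have strong beta := l1_objective_strong_min f beta hLN hPhi homega (ltW hlambda) hmu0.
have uniq_b : unique (is_minimizer (l1_objective Phi x omega f lambda mu)) b.
  split=> [beta|beta min_beta].
    apply: le_trans (strong beta); rewrite lerDl.
    by apply: sumr_ge0 => l _; apply: sqr_ge0.
  (* The excess at another minimizer is at most 0, so every term vanishes. *)
  have := le_trans (strong beta) (min_beta b); rewrite gerDl => dist_le0.
  have dist_ge0 : \sum_l (beta l 0 - b l 0) ^+ 2 >= 0.
    by apply: sumr_ge0 => l _; apply: sqr_ge0.
  have dist0 : \sum_l (beta l 0 - b l 0) ^+ 2 = 0.
    by apply/le_anti; rewrite dist_le0.
  apply/matrixP => l j; rewrite ord1; apply/esym/eqP; rewrite -subr_eq0 -sqrf_eq0.
  by apply/eqP; apply: (psumr_eq0P _ dist0) => // i _; apply: sqr_ge0.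
split=> // p [beta /uniq_b.2 <- ->] t.
rewrite horner_sum mulr_sumr; apply: eq_bigr => l _.
by rewrite hornerZ mxE mulrA.
Qed.
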